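(* Let $A\in\mathbb{R}^{m\times n}$ have a gap after the $k$th singular value, $$\|A\|_2=\sigma_1(A)\ge\cdots\ge\sigma_k(A)>\sigma_{k+1}(A)\ge\cdots\ge\sigma_r(A)\ge0,\qquad r\equiv\min\{m,n\}.$$ Let $P_k\equiv A_kA_k^{\dagger}$ be the orthogonal projector onto the dominant $k$-dimensional left singular subspace of $A$, and let $P\in\mathbb{R}^{m\times m}$ be an orthogonal projector ($P^2=P=P^T$) with $k\le\operatorname{rank}(P)<m-k$. Then for every Schatten $p$-norm $\|\cdot\|_{(p)}$, $$\sigma_k(A)\,\|\sin\Theta(P,P_k)\|_{(p)}\ \le\ \|(I-P)A\|_{(p)}\ \le\ \|A\|_2\,\|\sin\Theta(P,P_k)\|_{(p)}+\|A-A_k\|_{(p)}.$$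
   Context: The Schatten $p$-norm of a real matrix $M$ with singular values $\sigma_1(M)\ge\dots\ge\sigma_r(M)\ge0$ is $\|M\|_{(p)}=\left(\sum_{j=1}^r\sigma_j(M)^p\right)^{1/p}$ for integers $p\ge1$, and $\|M\|_{(\infty)}=\|M\|_2=\sigma_1(M)$ for $p=\infty$. $M^\dagger$ is the Moore-Penrose inverse. With a full SVD $A=U\Sigma V^T$ (singular values in non-increasing order), $A_k=U_k\Sigma_kV_k^T=U_kU_k^TA$, where $U_k,V_k$ are the leading $k$ columns of $U,V$ and $\Sigma_k=\operatorname{diag}(\sigma_1(A),\dots,\sigma_k(A))$; thus $P_k=U_kU_k^T$. Principal angles: for two subspaces with orthonormal bases given by the columns of $Z\in\mathbb{R}^{m\times k}$ and $\hat Z\in\mathbb{R}^{m\times\ell}$, $\ell\ge k$, the $k$ principal angles $\theta_1,\dots,\theta_k\in[0,\pi/2]$ are defined by $\cos\theta_j$ being the $k$ singular values of $Z^T\hat Z$. For orthogonal projectors $P,Q$, $\sin\Theta(P,Q)$ is the diagonal matrix $\operatorname{diag}(\sin\theta_1,\dots,\sin\theta_k)$, with $\theta_j$ the principal angles between $\operatorname{range}(P)$ and $\operatorname{range}(Q)$ and $k$ the smaller of the two ranks. *)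

(* Defs.v *)
From HB Require Import structures.
From mathcomp Require Import all_boot all_order all_algebra.
From mathcomp Require Import all_classical all_reals all_analysis.
From mathcomp Require Import ring lra.
Set Implicit Arguments.
Unset Strict Implicit.
Unset Printing Implicit Defensive.
Import Order.TTheory GRing.Theory Num.Theory.
Import numFieldNormedType.Exports.
Local Open Scope classical_set_scope.
Local Open Scope ring_scope.

Section Definitions.
Variable R : realType.

Definition rect_diag m n (s : seq R) : 'M[R]_(m, n) :=
  \matrix_(i, j) (s`_i *+ (i == j :> nat)).

(** Full singular value decomposition [A = U Sigma V^T]; the entries of [s] are
    the singular values of [A], with multiplicity, in non-increasing order. *)
Record is_svd m n (A : 'M[R]_(m, n)) (U : 'M[R]_m) (s : seq R) (V : 'M[R]_n) :
    Prop := IsSvd {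
  svd_left_orthogonal : U^T *m U = 1%:M;
  svd_right_orthogonal : V^T *m V = 1%:M;
  svd_size : size s = minn m n;
  svd_sorted : sorted >=%R s;
  svd_ge0 : {in s, forall x, 0 <= x};
  svd_eq : A = U *m rect_diag m n s *m V^T }.

(** The default value [[::]] is never used, see [singular_valuesP]. *)
Definition singular_values m n (A : 'M[R]_(m, n)) : seq R :=
  xget [::] [set s | exists U V, is_svd A U s V].

(** [singular_value A j] is sigma_j(A), numbered from [j = 1]. *)
Definition singular_value m n (A : 'M[R]_(m, n)) (j : nat) : R :=
  (singular_values A)`_j.-1.

Definition spectral_norm m n (A : 'M[R]_(m, n)) : R := singular_value A 1.

(** [Some p] is the finite exponent [p] (meaningful for [p >= 1]) and [None] is
    the exponent infinity. *)
Definition schatten_norm (p : option nat) m n (A : 'M[R]_(m, n)) : R :=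
  if p is Some q then (\sum_(x <- singular_values A) x ^+ q) `^ (q%:R^-1)
  else spectral_norm A.

Definition is_moore_penrose m n (A : 'M[R]_(m, n)) (X : 'M[R]_(n, m)) : Prop :=
  [/\ A *m X *m A = A, X *m A *m X = X,
      (A *m X)^T = A *m X & (X *m A)^T = X *m A].

(** The default value [0] is never used, see [moore_penroseP]. *)
Definition moore_penrose m n (A : 'M[R]_(m, n)) : 'M[R]_(n, m) :=
  xget 0 [set X | is_moore_penrose A X].

(** For [k <= m], the leading [k] columns of [U]. *)
Definition leading_cols m k (U : 'M[R]_m) : 'M[R]_(m, k) := U *m pid_mx k.

(** [U_k Sigma_k V_k^T]. *)
Definition truncated_svd m n (U : 'M[R]_m) (s : seq R) (V : 'M[R]_n) (k : nat) :
    'M[R]_(m, n) :=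
  leading_cols k U *m diag_mx (\row_(j < k) s`_j) *m (leading_cols k V)^T.

Definition is_orthogonal_projector m (P : 'M[R]_m) : Prop :=
  P *m P = P /\ P^T = P.

(** The columns of [Z] are orthonormal and span the range (column space) of [P];
    [%MS] compares row spaces, hence the transpositions. *)
Definition is_orthonormal_basis m k (P : 'M[R]_m) (Z : 'M[R]_(m, k)) : Prop :=
  Z^T *m Z = 1%:M /\ (Z^T == P^T)%MS.

(** The default value [0] is never used, see [range_basisP]. *)
Definition range_basis m (P : 'M[R]_m) : 'M[R]_(m, \rank P) :=
  xget 0 [set Z | is_orthonormal_basis P Z].

(** The [j]-th principal angle, [j >= 1], between the spans of the columns of
    [Z] and [Z']; there are [minn k l] of them, and exchanging [Z] and [Z']
    transposes [Z^T *m Z'], which does not change its singular values. *)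
Definition principal_angle m k l (Z : 'M[R]_(m, k)) (Z' : 'M[R]_(m, l))
    (j : nat) : R :=
  acos (singular_value (Z^T *m Z') j).

Definition sin_Theta m (P Q : 'M[R]_m) : 'M[R]_(minn (\rank P) (\rank Q)) :=
  diag_mx (\row_j sin (principal_angle (range_basis P) (range_basis Q) j.+1)).

End Definitions.

Section WellDefined.
Variable R : realType.

Let dot n (u v : 'rV[R]_n) : R := (u *m v^T) 0 0.

Local Lemma dotE n (u v : 'rV[R]_n) : dot u v = \sum_i u 0 i * v 0 i.
Proof. by rewrite /dot mxE; apply: eq_bigr => i _; rewrite mxE. Qed.

Local Lemma mx11_eq (a b : 'M[R]_1) : a 0 0 = b 0 0 -> a = b.
Proof. by move=> h; apply/matrixP => i j; rewrite !ord1. Qed.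

Local Lemma dotC n (u v : 'rV[R]_n) : dot u v = dot v u.
Proof. by rewrite !dotE; apply: eq_bigr => i _; rewrite mulrC. Qed.

Local Lemma dotBl n (u v w : 'rV[R]_n) : dot (u - v) w = dot u w - dot v w.
Proof. by rewrite /dot mulmxBl !mxE. Qed.

Local Lemma dotZl n a (u w : 'rV[R]_n) : dot (a *: u) w = a * dot u w.
Proof. by rewrite /dot -scalemxAl mxE. Qed.

Local Lemma dot_ge0 n (u : 'rV[R]_n) : 0 <= dot u u.
Proof. by rewrite dotE sumr_ge0 // => i _; rewrite -expr2 sqr_ge0. Qed.

Local Lemma dot_eq0 n (u : 'rV[R]_n) : dot u u = 0 -> u = 0.
Proof.
rewrite dotE => /eqP; rewrite psumr_eq0; last first.
  by move=> i _; rewrite -expr2 sqr_ge0.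
move=> /allP h; apply/rowP => i; rewrite mxE.
by apply/eqP; have := h i (mem_index_enum i); rewrite /= mulf_eq0 orbb.
Qed.

Local Lemma continuous_sum (T : topologicalType) n (F : 'I_n -> T -> R) :
  (forall i, continuous (F i)) -> continuous (fun x => \sum_i F i x).
Proof. by move=> h; apply: continuous_big => // -[x y]; exact: add_continuous. Qed.

Local Lemma sphere_compact n : compact [set u : 'rV[R]_n | dot u u = 1].
Proof.
apply: bounded_closed_compact.
  exists 1; split => // M M1 u /= u1.
  rewrite /Num.norm /= mx_normrE; apply/bigmax_leP; split; first exact: ltW (lt_trans ltr01 M1).
  move=> [i j] _ /=; rewrite ord1; apply: (le_trans _ (ltW M1)).
  rewrite -(@ler_pXn2r _ 2) ?nnegrE// expr1n real_normK ?num_real//.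
  rewrite -u1 dotE (bigD1 j)//= -expr2 lerDl sumr_ge0// => k _.
  by rewrite -expr2 sqr_ge0.
have cd : continuous (fun u : 'rV[R]_n => dot u u).
  rewrite (_ : (fun u => _) = fun u : 'rV[R]_n => \sum_i u 0 i * u 0 i); last first.
    by apply/funext => u; rewrite dotE.
  apply: continuous_sum => i u.
  by apply: continuousM; exact: coord_continuous.
rewrite (_ : [set u | _] = (fun u : 'rV[R]_n => dot u u) @^-1` [set 1])//.
by apply: closed_comp => [u _|]; [exact: cd|exact: closed_eq].
Qed.

Local Lemma bilinear_max m n (A : 'M[R]_(m.+1, n.+1)) :
  exists u v, [/\ dot u u = 1, dot v v = 1 &
    forall x y, dot x x = 1 -> dot y y = 1 -> dot (x *m A) y <= dot (u *m A) v].
Proof.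
have e1 k : dot (delta_mx 0 0 : 'rV[R]_k.+1) (delta_mx 0 0) = 1.
  by rewrite /dot trmx_delta mul_delta_mx mxE.
pose f (w : 'rV[R]_m.+1 * 'rV[R]_n.+1) := dot (w.1 *m A) w.2.
have cf : continuous f.
  rewrite (_ : f = fun w : 'rV[R]_m.+1 * 'rV[R]_n.+1 => \sum_j (\sum_i w.1 0 i * A i j) * w.2 0 j); last first.
    by apply/funext => w; rewrite /f dotE; apply: eq_bigr => j _; rewrite mxE.
  apply: continuous_sum => j w; apply: continuousM; last first.
    apply: (@continuous_comp _ _ _ snd (fun y : 'rV[R]_n.+1 => y 0 j)); first exact: cvg_snd.
    exact: coord_continuous.
  move: w; apply: continuous_sum => i w; apply: continuousM; last exact: cst_continuous.
  apply: (@continuous_comp _ _ _ fst (fun y : 'rV[R]_m.+1 => y 0 i)); first exact: cvg_fst.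
  exact: coord_continuous.
have [||[u v]] := @compact_EVT_max _ R f _ _ (compact_setX (@sphere_compact m.+1) (@sphere_compact n.+1)).
- by exists (delta_mx 0 0, delta_mx 0 0); split; exact: e1.
- by apply: continuous_subspaceT.
rewrite inE => -[/= u1 v1] h; exists u, v; split => // x y x1 y1.
by apply: (h (x, y)); rewrite inE.
Qed.

Local Lemma maximizer m n (A : 'M[R]_(m, n)) u v :
  dot u u = 1 ->
  (forall x, dot x x = 1 -> dot (x *m A) v <= dot (u *m A) v) ->
  v *m A^T = dot (u *m A) v *: u.
Proof.
move=> u1 h; set w := v *m A^T; set t := dot _ _.
have dw x : dot (x *m A) v = dot x w.
  by rewrite /dot /w trmx_mul trmxK mulmxA.
have tE : t = dot u w by rewrite /t dw.
have [w0|w0] := eqVneq (dot w w) 0.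
  by have -> := dot_eq0 w0; rewrite tE (dot_eq0 w0) /dot trmx0 mulmx0 mxE scale0r.
have wp : 0 < dot w w by rewrite lt_neqAle eq_sym w0 dot_ge0.
pose c := Num.sqrt (dot w w).
have c0 : c != 0 by rewrite gt_eqF // sqrtr_gt0.
have c2 : c ^+ 2 = dot w w by rewrite sqr_sqrtr // ltW.
have /h : dot (c^-1 *: w) (c^-1 *: w) = 1.
  by rewrite dotZl dotC dotZl -c2; field.
rewrite dw -/t dotZl -c2 => ct.
have {}ct : c <= t by apply: le_trans ct; rewrite expr2 mulrA mulVf ?mul1r.
apply/eqP; rewrite -subr_eq0; apply/eqP/dot_eq0/eqP.
rewrite eq_le dot_ge0 andbT.
have -> : dot (w - t *: u) (w - t *: u) = c ^+ 2 - t ^+ 2.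
  rewrite dotBl dotZl (dotC w (w - _)) (dotC u (w - _)) !dotBl !dotZl.
  by rewrite (dotC w u) u1 -tE -c2; ring.
rewrite subr_le0 ler_pXn2r ?nnegrE ?sqrtr_ge0//.
by apply: le_trans ct; rewrite sqrtr_ge0.
Qed.

Local Lemma householder n (u : 'rV[R]_n.+1) : dot u u = 1 ->
  exists2 H : 'M[R]_n.+1, H^T *m H = 1%:M & row 0 H = u.
Proof.
move=> u1; pose e : 'rV[R]_n.+1 := delta_mx 0 0.
have rE (H : 'M[R]_n.+1) : row 0 H = e *m H by rewrite rowE.
have [->|ue] := eqVneq u e.
  by exists 1%:M; rewrite ?trmx1 ?mulmx1 // rE mulmx1.
have e1 : dot e e = 1 by rewrite /dot trmx_delta mul_delta_mx mxE.
pose w := e - u; pose d := dot w w.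
have d0 : d != 0.
  by apply/eqP => /dot_eq0/eqP; rewrite subr_eq0 eq_sym (negPf ue).
have wwE : w *m w^T = d%:M by apply: mx11_eq; rewrite [RHS]mxE eqxx.
pose H := 1%:M - (2 / d) *: (w^T *m w).
have HT : H^T = H.
  by rewrite /H linearB /= linearZ /= trmx1 trmx_mul trmxK.
exists H.
  have -> : H^T *m H = H - H *m ((2 / d) *: (w^T *m w)).
    by rewrite HT {2}/H mulmxBr mulmx1.
  rewrite /H mulmxBl mul1mx -scalemxAl -scalemxAr mulmxA -(mulmxA w^T w) wwE.
  rewrite mul_mx_scalar -scalemxAl !scalerA (_ : 2 / d * (2 / d * d) = 2 / d + 2 / d); last by field.
  by rewrite scalerDl; apply/matrixP => i j; rewrite !mxE; ring.
rewrite rE /H mulmxBr mulmx1 -scalemxAr mulmxA.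
have -> : e *m w^T = (d / 2)%:M.
  apply: mx11_eq; rewrite [RHS]mxE eqxx mulr1n -/(dot e w) dotC dotBl e1.
  by rewrite /d /w !dotBl !(dotC _ (e - u)) !dotBl e1 u1 (dotC e u); field.
rewrite mul_scalar_mx scalerA (_ : 2 / d * (d / 2) = 1) ?scale1r; last by field.
by rewrite opprB addrC subrK.
Qed.

Local Lemma rect_diag_cons m n x s :
  rect_diag (1 + m) (1 + n) (x :: s) =
  block_mx x%:M 0 0 (rect_diag m n s) :> 'M[R]_(1 + m, 1 + n).
Proof.
apply/matrixP => i j; rewrite !mxE.
case: splitP => i' ->; rewrite !mxE; case: splitP => j' ->; rewrite ?ord1 !mxE ?mulr0n//.
Qed.

Lemma svd_exists m n (A : 'M[R]_(m, n)) : exists U s V, is_svd A U s V.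
Proof.
elim: m n A => [|m IH] n A.
  exists 1%:M, [::], 1%:M; split; rewrite ?trmx1 ?mulmx1 ?min0n //.
  by apply/matrixP => -[].
case: n A => [|n] A.
  exists 1%:M, [::], 1%:M; split; rewrite ?trmx1 ?mulmx1 ?minn0 //.
  by apply/matrixP => i [].
have [u [v [u1 v1 uv]]] := bilinear_max A.
set t := dot (u *m A) v in uv.
have Av : v *m A^T = t *: u by apply: maximizer => // x x1; exact: uv.
have dT (x : 'rV[R]_m.+1) y : dot (y *m A^T) x = dot (x *m A) y.
  by rewrite dotC /dot trmx_mul trmxK mulmxA.
have Au : u *m A = t *: v.
  rewrite -[A]trmxK /t -dT; apply: maximizer => // y y1.
  by rewrite !dT; exact: uv.
have t0 : 0 <= t.
  have /(uv _ v) : dot (- u) (- u) = 1.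
    by rewrite /dot linearN /= mulmxN mulNmx opprK.
  move=> /(_ v1); have -> : dot (- u *m A) v = - t.
    by rewrite /t /dot !mulNmx mxE.
  by clear; move=> ?; lra.
have [H HH Hu] : exists2 H : 'M[R]_(1 + m), H^T *m H = 1%:M & row 0 H = u := householder u1.
have [K KK Kv] : exists2 K : 'M[R]_(1 + n), K^T *m K = 1%:M & row 0 K = v := householder v1.
have HH' := mulmx1C HH; have KK' := mulmx1C KK.
have [M MdE] : exists M : 'M[R]_(1 + m, 1 + n), M = H *m A *m K^T by eexists.
pose B := drsubmx M.
have uH : u *m H^T = delta_mx 0 0 by rewrite -Hu rowE -mulmxA HH' mulmx1.
have vK : v *m K^T = delta_mx 0 0 by rewrite -Kv rowE -mulmxA KK' mulmx1.
have M0 : row 0 M = t *: delta_mx 0 0.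
  by rewrite rowE MdE !mulmxA -rowE Hu Au -scalemxAl vK.
have M0' : row 0 M^T = t *: delta_mx 0 0.
  by rewrite rowE MdE !trmx_mul trmxK !mulmxA -rowE Kv Av -scalemxAl uH.
have ME : M = block_mx t%:M 0 0 B.
  rewrite -[LHS]submxK; congr block_mx; apply/matrixP => i j; rewrite ?ord1.
  - have /rowP/(_ 0) := M0; rewrite !mxE eqxx mulr1 => <-.
    by congr (M _ _); apply/val_inj.
  - have /rowP/(_ (rshift 1 j)) := M0; rewrite !mxE /= => h.
    rewrite (_ : lshift m 0 = 0); last exact/val_inj.
    by rewrite h mulr0n mulr0.
  - have /rowP/(_ (rshift 1 i)) := M0'; rewrite !mxE /= => h.
    rewrite (_ : lshift n 0 = 0); last exact/val_inj.
    by rewrite h mulr0n mulr0.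
have Bt x y : dot x x = 1 -> dot y y = 1 -> dot (x *m B) y <= t.
  have unitK k (z : 'rV[R]_k) (W : 'M[R]_(1 + k)) : W *m W^T = 1%:M ->
      dot z z = 1 -> dot (row_mx 0 z *m W) (row_mx 0 z *m W) = 1.
    move=> WW z1; rewrite /dot trmx_mul mulmxA -(mulmxA _ W) WW mulmx1.
    by rewrite tr_row_mx mul_row_col mul0mx add0r.
  move=> x1 y1; apply: le_trans (uv _ _ (unitK _ _ H HH' x1) (unitK _ _ K KK' y1)).
  rewrite {2}/dot trmx_mul !mulmxA.
  rewrite -(mulmxA (row_mx 0 x)) -(mulmxA (row_mx 0 x)) -MdE ME.
  rewrite mul_row_block tr_row_mx mul_row_col !mul0mx !mulmx0 trmx0 mulmx0.
  by rewrite !add0r.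
have [U [s [V [UU VV sz so sp BE]]]] := IH _ B.
pose U1 : 'M[R]_(1 + m) := block_mx 1%:M 0 0 U.
pose V1 : 'M[R]_(1 + n) := block_mx 1%:M 0 0 V.
have blockO k (W : 'M[R]_k) : W^T *m W = 1%:M ->
    (block_mx 1%:M 0 0 W : 'M[R]_(1 + k))^T *m block_mx 1%:M 0 0 W = 1%:M.
  move=> WW; rewrite tr_block_mx mulmx_block !trmx0 trmx1 !mul0mx !mulmx0 !mulmx1.
  by rewrite WW !addr0 add0r -scalar_mx_block.
have V1T : V1^T = block_mx 1%:M 0 0 V^T by rewrite tr_block_mx !trmx0 trmx1.
have AE : A = (H^T *m U1) *m rect_diag (1 + m) (1 + n) (t :: s) *m (K^T *m V1)^T.
  rewrite trmx_mul trmxK -!mulmxA.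
  rewrite [U1 *m _](_ : _ = M *m K); last first.
    rewrite !mulmxA; congr (_ *m _).
    rewrite rect_diag_cons V1T /U1 !mulmx_block.
    rewrite !mul0mx !mulmx0 !addr0 !mul1mx !mulmx1 !add0r ?mul0mx ?mulmx0 ?addr0 ?add0r.
    by rewrite -BE -ME.
  by rewrite MdE -!mulmxA KK mulmx1 mulmxA HH mul1mx.
exists (H^T *m U1), (t :: s), (K^T *m V1); split => //.
- by rewrite trmx_mul trmxK mulmxA -(mulmxA U1^T) HH' mulmx1 blockO.
- by rewrite trmx_mul trmxK mulmxA -(mulmxA V1^T) KK' mulmx1 blockO.
- by rewrite /= sz minnSS.
- case: s sz so sp BE {AE} => [//|s0 s] sz so sp BE; move: so => /= ->; rewrite andbT.
  have mn0 : (0 < minn m n)%N by rewrite -sz.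
  have m0 : (0 < m)%N by apply: leq_trans mn0 (geq_minl _ _).
  have n0 : (0 < n)%N by apply: leq_trans mn0 (geq_minr _ _).
  have eunit k (i : 'I_k) (W : 'M[R]_k) : W^T *m W = 1%:M ->
      dot (delta_mx 0 i *m W^T) (delta_mx 0 i *m W^T) = 1.
    move=> WW; rewrite /dot trmx_mul trmxK mulmxA -(mulmxA _ W^T) WW mulmx1.
    by rewrite trmx_delta mul_delta_mx mxE.
  have := Bt _ _ (eunit _ (Ordinal m0) _ UU) (eunit _ (Ordinal n0) _ VV).
  rewrite BE /dot trmx_mul trmxK !mulmxA -(mulmxA _ U^T) UU mulmx1.
  rewrite -(mulmxA _ V^T) VV mulmx1 trmx_delta -rowE -colE !mxE /=.
  by rewrite mulr1n.
- by move=> x; rewrite inE => /orP[/eqP->//|]; exact: sp.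
Qed.

Let D m n (f : nat -> R) : 'M[R]_(m, n) :=
  \matrix_(i, j) (f i *+ (i == j :> nat)).

Local Lemma D_mul m n p f g : (forall i, (n <= i)%N -> f i = 0) ->
  D m n f *m D n p g = D m p (fun i => f i * g i).
Proof.
move=> f0; apply/matrixP => i j; rewrite !mxE.
have [ni|ni] := ltnP i n; last first.
  by rewrite f0 // mul0r mul0rn big1 // => k _; rewrite !mxE f0 // mul0rn mul0r.
rewrite (bigD1 (Ordinal ni)) //= big1 ?addr0 => [|k]; rewrite !mxE /=.
  by rewrite eqxx mulr1n -mulrnAr.
rewrite -val_eqE /= eq_sym => /negPf ->.
by rewrite mulr0n mul0r.
Qed.

Local Lemma tr_D m n f : (D m n f)^T = D n m f.
Proof.
by apply/matrixP => i j; rewrite !mxE; case: eqVneq => [->|]; rewrite ?eqxx // eq_sym => /negPf->.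
Qed.

Local Lemma eq_D m n f g : f =1 g -> D m n f = D m n g.
Proof. by move=> fg; apply/matrixP => i j; rewrite !mxE fg. Qed.

Lemma moore_penrose_unique m n (A : 'M[R]_(m, n)) X Y :
  is_moore_penrose A X -> is_moore_penrose A Y -> X = Y.
Proof.
move=> [AXA XAX AXT XAT] [AYA YAY AYT YAT].
have AXY : A *m X = A *m Y.
  by rewrite -AXT -{1}AYA -mulmxA trmx_mul AXT AYT mulmxA AXA.
have XYA : X *m A = Y *m A.
  rewrite -XAT -{1}AYA -(mulmxA A) mulmxA trmx_mul YAT XAT.
  by rewrite -mulmxA [A *m _]mulmxA AXA.
by rewrite -XAX -mulmxA AXY mulmxA XYA YAY.
Qed.

Lemma moore_penroseP m n (A : 'M[R]_(m, n)) :
  is_moore_penrose A (moore_penrose A).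
Proof.
suff [X AX] : exists X, is_moore_penrose A X.
  exact: (@xgetPex _ 0 [set X | is_moore_penrose A X] (ex_intro _ X AX)).
have [U [s [V [UU VV sz _ _ ->]]]] := svd_exists A.
rewrite -/(D m n (nth 0 s)).
have s0 i : (minn m n <= i)%N -> s`_i = 0 by move=> h; rewrite nth_default // sz.
have sm i : (m <= i)%N -> s`_i = 0.
  by move=> h; apply: s0; rewrite geq_min h.
have sn i : (n <= i)%N -> s`_i = 0.
  by move=> h; apply: s0; rewrite geq_min h orbT.
have sVm i : (m <= i)%N -> (s`_i)^-1 = 0 by move=> /sm ->; rewrite invr0.
have sVn i : (n <= i)%N -> (s`_i)^-1 = 0 by move=> /sn ->; rewrite invr0.
have UDV k l p (W : 'M[R]_k) (X : 'M[R]_l) (Y : 'M[R]_p) f g :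
    X^T *m X = 1%:M -> (forall i, (l <= i)%N -> f i = 0) ->
    (W *m D k l f *m X^T) *m (X *m D l p g *m Y^T) = W *m D k p (fun i => f i * g i) *m Y^T.
  move=> XX f0; rewrite -(D_mul _ _ _ f0).
  by rewrite !mulmxA -(mulmxA _ X^T) XX mulmx1.
have s3 x : x * x^-1 * x = x :> R.
  by have [->|x0] := eqVneq x 0; rewrite ?mulr0 // divfK.
have s3' x : x^-1 * x * x^-1 = x^-1 :> R.
  by have [->|x0] := eqVneq x 0; rewrite ?mulr0 ?invr0 ?mulr0 // mulVf ?mul1r.
exists (V *m D n m (fun i => (s`_i)^-1) *m U^T); split.
- rewrite !UDV // => [|i /sm ->]; last by rewrite mul0r.
  by rewrite (eq_D _ _ (fun i => s3 s`_i)).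
- rewrite !UDV // => [|i /sn ->]; last by rewrite mulr0.
  by rewrite (eq_D _ _ (fun i => s3' s`_i)).
- by rewrite UDV // !trmx_mul trmxK tr_D mulmxA.
- by rewrite UDV // !trmx_mul trmxK tr_D mulmxA.
Qed.

Lemma range_basisP m (P : 'M[R]_m) : is_orthonormal_basis P (range_basis P).
Proof.
suff [Z PZ] : exists Z : 'M[R]_(m, \rank P), is_orthonormal_basis P Z.
  exact: (@xgetPex _ 0 [set Z : 'M[R]_(m, \rank P) | is_orthonormal_basis P Z] (ex_intro _ Z PZ)).
pose F := (col_base P)^T.
have FP : (P^T == F)%MS.
  rewrite -mxrank_leqif_eq; last first.
    by apply/submxP; exists (row_base P)^T; rewrite /F -trmx_mul mulmx_base.
  by rewrite /F !mxrank_tr eq_sym; exact: col_base_full.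
have Frank : \rank F = \rank P by rewrite -(eqmxP FP) mxrank_tr.
move: F FP Frank; set r := \rank P => F FP Frank.
have [U [s [V [UU VV sz _ _ FE]]]] := svd_exists F.
rewrite -/(D _ _ (nth 0 s)) in FE.
have rm : (r <= m)%N by rewrite /r rank_leq_row.
have UU' := mulmx1C UU.
have s_neq0 (i : 'I_r) : s`_i != 0.
  apply/eqP => si0.
  have /row_freeP[G FG] : row_free F by rewrite /row_free Frank.
  have : (delta_mx 0 i : 'rV[R]_r) *m U^T *m F = 0.
    rewrite FE !mulmxA -(mulmxA _ U^T) UU mulmx1 -rowE.
    rewrite (_ : row i _ = 0) ?mul0mx //.
    by apply/rowP => j; rewrite !mxE si0 mul0rn.
  move=> /(congr1 (fun x => x *m G *m U)); rewrite -(mulmxA _ F) FG mulmx1.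
  rewrite !mul0mx -mulmxA UU mulmx1 => /matrixP/(_ 0 i).
  by rewrite !mxE !eqxx => /eqP; rewrite oner_eq0.
pose W := D r r (fun i => (s`_i)^-1) *m U^T *m F.
have WE : W = D r m (fun=> 1) *m V^T.
  rewrite /W FE !mulmxA -(mulmxA _ U^T) UU mulmx1; congr (_ *m _).
  rewrite D_mul => [|i ri]; last by rewrite nth_default ?invr0 // sz (minn_idPl rm).
  apply/matrixP => i j; rewrite !mxE mulVf //.
have WW : W *m W^T = 1%:M.
  rewrite WE trmx_mul trmxK tr_D !mulmxA -(mulmxA _ V^T) VV mulmx1.
  apply/matrixP => i j; rewrite !mxE.
  rewrite (bigD1 (widen_ord rm i)) //= big1 ?addr0 => [|k]; rewrite !mxE /=.
    by rewrite eqxx mul1r.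
  by rewrite -val_eqE /= eq_sym => /negPf ->; rewrite mul0r.
exists W^T; split; first by rewrite trmxK.
rewrite trmxK; apply/eqmxP/(eqmx_trans _ (eqmx_sym (eqmxP FP)))/eqmxP.
rewrite -mxrank_leqif_eq ?submxMl // Frank.
have : row_free W by apply/row_freeP; exists W^T.
by [].
Qed.

Lemma svd_unique m n (A : 'M[R]_(m, n)) U s V U' s' V' :
  is_svd A U s V -> is_svd A U' s' V' -> s = s'.
Proof.
pose sq (s : seq R) := mkseq (fun i => s`_i ^+ 2) n.
have cp U0 s0 V0 : is_svd A U0 s0 V0 ->
    char_poly (A^T *m A) = \prod_(x <- sq s0) ('X - x%:P).
  move=> [UU VV sz _ _ ->]; rewrite -/(D _ _ (nth 0 s0)).
  rewrite !trmx_mul trmxK !mulmxA -(mulmxA _ U0^T) UU mulmx1 tr_D.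
  rewrite -(mulmxA V0) D_mul; last first.
    by move=> i mi; rewrite nth_default // sz (leq_trans (geq_minl _ _)).
  set E := D _ _ _.
  have -> : char_poly (V0 *m E *m V0^T) = char_poly E.
    rewrite /char_poly.
    have VV' : map_mx polyC V0 *m map_mx polyC V0^T = 1%:M.
      by rewrite -map_mxM (mulmx1C VV) map_mx1.
    have -> : char_poly_mx (V0 *m E *m V0^T) =
        map_mx polyC V0 *m char_poly_mx E *m map_mx polyC V0^T.
      rewrite /char_poly_mx mulmxBr mulmxBl !map_mxM mul_mx_scalar -scalemxAl.
      by rewrite VV' scalemx1.
    by rewrite !det_mulmx mulrAC -det_mulmx VV' det1 mul1r.
  rewrite char_poly_trig; last first.
    apply/is_trig_mxP => i j ij; rewrite mxE.
    by rewrite (ltn_eqF ij) mulr0n.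
  have -> : sq s0 = [seq s0`_i ^+ 2 | i <- index_iota 0 n].
    by rewrite /index_iota subn0.
  rewrite big_map big_mkord.
  by apply: eq_bigr => i _; rewrite mxE eqxx mulr1n expr2.
have sso U0 s0 V0 : is_svd A U0 s0 V0 -> sorted >=%R (sq s0).
  move=> [_ _ _ so sp _].
  apply/(sortedP 0) => i; rewrite size_mkseq => hi.
  rewrite !nth_mkseq // ?(ltnW hi) //.
  have s_ge0 j : 0 <= s0`_j.
    have [js|js] := ltnP j (size s0); last by rewrite nth_default.
    by apply: sp; rewrite mem_nth.
  rewrite /= ler_pXn2r ?nnegrE //.
  have [js|js] := ltnP i.+1 (size s0); last by rewrite nth_default.
  by move/(sortedP 0): so => /(_ _ js).
move=> h h'.
have pe : perm_eq (sq s) (sq s').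
  by apply: prod_XsubC_eq; rewrite -(cp _ _ _ h) -(cp _ _ _ h').
have e : sq s = sq s'.
  apply: (@sorted_eq _ >=%R) => //; [|by move=> x y /andP[? ?]; apply/le_anti/andP; split|exact: sso h|exact: sso h'].
  by move=> x y z xy yz; apply: le_trans yz xy.
have sp t U0 V0 j : is_svd A U0 t V0 -> 0 <= t`_j.
  move=> [_ _ _ _ sp _].
  have [js|js] := ltnP j (size t); last by rewrite nth_default.
  by apply: sp; rewrite mem_nth.
apply: (@eq_from_nth _ 0); first by rewrite (svd_size h) (svd_size h').
move=> i; rewrite (svd_size h) leq_min => /andP[_ ni].
have := congr1 (fun t => t`_i) e; rewrite !nth_mkseq // => /eqP.
by rewrite eqrXn2 ?(sp _ _ _ _ h) ?(sp _ _ _ _ h') // => /eqP.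
Qed.

Lemma singular_valuesP m n (A : 'M[R]_(m, n)) :
  exists U V, is_svd A U (singular_values A) V.
Proof.
have [U [s [V h]]] := svd_exists A.
exact: (@xgetPex _ [::] [set s | exists U V, is_svd A U s V] (ex_intro _ s (ex_intro _ U (ex_intro _ V h)))).
Qed.

End WellDefined.

(* Main.v *)
Require Import Defs.
From HB Require Import structures.
From mathcomp Require Import all_boot all_order all_algebra.
From mathcomp Require Import all_classical all_reals all_analysis.
From mathcomp Require Import ring lra.
Import Order.TTheory GRing.Theory Num.Theory.
Import numFieldNormedType.Exports.
Local Open Scope ring_scope.

(** Let [Y] be an orthonormal basis of the range of [P_k = U_k U_k^T].  The key
    identity is that the sines of the principal angles between [P] and [P_k] have
    the same Schatten norms as [(1 - P) Y] ([sin_Theta_norm]).  The two bounds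
    then compare [(1 - P) A] with [(1 - P) Y] through factorisations whose
    extra factor is a contraction, and multiplication by a contraction never
    increases a Schatten norm ([schatten_norm_ideal]).

    For the lower bound, [A V_k = U_k Sigma_k] gives
    [sigma_k (1 - P) Y = (1 - P) A (V_k (sigma_k Sigma_k^-1) U_k^T Y)], and the
    bracket is a contraction because [sigma_k <= sigma_j] for [j <= k].  The gap
    makes [sigma_k] positive, so that [Sigma_k] is invertible.

    For the upper bound, [(1 - P) A = (1 - P) A_k + (1 - P) (A - A_k)].  The
    second term is at most [A - A_k] in norm.  The first one is
    [sigma_1 (1 - P) Y (Y^T A_k / sigma_1)], because [P_k A_k = A_k], and its
    bracket is a contraction.  The triangle inequality [schatten_normD]
    concludes.

    The Schatten norms are handled by a variational principle: the norm of [A] is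
    the largest lp norm of a diagonal of [L A N], for [L] and [N] contractions
    ([schatten_norm_attained], [lp_norm_compression_le]).  The ideal property
    follows because contractions compose, and the triangle inequality follows from
    Minkowski's inequality for vectors because diagonals are additive.  The
    maximality holds because the entries of such a diagonal are dominated by
    averages of the singular values with doubly substochastic weights
    ([lp_norm_substochastic]). *)

(** * Finite lp norms *)

Section LpNorm.
Set Implicit Arguments.
Unset Strict Implicit.
Variable R : realType.

(** The exponent is encoded as in [schatten_norm], so that a Schatten norm is
    the lp norm of the singular values for the same exponent. *)
Definition lp_norm (p : option nat) r (f : 'I_r -> R) : R :=
  if p is Some q then (\sum_i `|f i| ^+ q) `^ (q%:R^-1)
  else \big[Num.max/0]_i `|f i|.

Lemma lp_norm_ge0 p r (f : 'I_r -> R) : 0 <= lp_norm p f.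
Proof.
by case: p => [q|]; [exact: powR_ge0|exact: bigmax_ge_id].
Qed.

Lemma sum_norm_expr_ge0 q r (f : 'I_r -> R) : 0 <= \sum_i `|f i| ^+ q.
Proof. by apply: sumr_ge0 => i _; rewrite exprn_ge0. Qed.

Lemma lp_norm_expr q r (f : 'I_r -> R) :
  lp_norm (Some q.+1) f ^+ q.+1 = \sum_i `|f i| ^+ q.+1.
Proof.
rewrite -powR_mulrn ?powR_ge0// -powRrM mulVf ?pnatr_eq0//.
by rewrite powRr1// sum_norm_expr_ge0.
Qed.

Lemma lp_norm_leP q r (f : 'I_r -> R) c : 0 <= c ->
  (lp_norm (Some q.+1) f <= c) = (\sum_i `|f i| ^+ q.+1 <= c ^+ q.+1).
Proof.
by move=> c0; rewrite -lp_norm_expr ler_pXn2r// nnegrE lp_norm_ge0.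
Qed.

Lemma lp_norm_infty_leP r (f : 'I_r -> R) c : 0 <= c ->
  (forall i, `|f i| <= c) -> lp_norm None f <= c.
Proof. by move=> c0 h; apply: bigmax_le. Qed.

Lemma le_lp_norm_infty r (f : 'I_r -> R) i : `|f i| <= lp_norm None f.
Proof. exact: (le_bigmax 0 (fun i => `|f i|)). Qed.

Lemma eq_lp_norm p r (f g : 'I_r -> R) : f =1 g -> lp_norm p f = lp_norm p g.
Proof. by move=> /funext ->. Qed.

Lemma eq_lp_norm_le p r (f g : 'I_r -> R) :
  f =1 g -> lp_norm p f <= lp_norm p g.
Proof. by move=> /eq_lp_norm ->. Qed.

(** The graph of the convex function [x ^+ q.+1] lies above its tangent at [y];
    summing such tangents at a weighted mean gives the two convexity
    inequalities below. *)
Lemma tangent_le_expr q (x y : R) : 0 <= x -> 0 <= y ->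
  y ^+ q.+1 + q.+1%:R * y ^+ q * (x - y) <= x ^+ q.+1.
Proof.
move=> x0 y0; elim: q => [|q IH].
  by rewrite expr0 !expr1 mulr1 mul1r addrC subrK.
rewrite [leRHS]exprS; apply: le_trans (ler_wpM2l x0 IH).
rewrite -subr_ge0.
have -> : x * (y ^+ q.+1 + q.+1%:R * y ^+ q * (x - y)) -
    (y ^+ q.+2 + q.+2%:R * y ^+ q.+1 * (x - y)) =
    q.+1%:R * y ^+ q * (x - y) ^+ 2.
  by rewrite -(natr1 q.+1) !exprS; ring.
by rewrite mulr_ge0 ?sqr_ge0 ?mulr_ge0 ?exprn_ge0 ?ler0n.
Qed.

(** Jensen's inequality: sum the tangent inequalities at the weighted mean [y].
    A total weight below 1 costs nothing, because the missing weight multiplies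
    the nonnegative quantity [q%:R * y ^+ q.+1]. *)
Lemma expr_substochastic_mean q r (d x : 'I_r -> R) :
  (forall i, 0 <= d i) -> \sum_i d i <= 1 -> (forall i, 0 <= x i) ->
  (\sum_i d i * x i) ^+ q.+1 <= \sum_i d i * x i ^+ q.+1.
Proof.
move=> d0 d1 x0; set y := \sum_i d i * x i.
have y0 : 0 <= y by apply: sumr_ge0 => i _; rewrite mulr_ge0.
have : \sum_i d i * (y ^+ q.+1 + q.+1%:R * y ^+ q * (x i - y)) <=
    \sum_i d i * x i ^+ q.+1.
  by apply: ler_sum => i _; rewrite ler_wpM2l// tangent_le_expr.
apply: le_trans.
have -> : \sum_i d i * (y ^+ q.+1 + q.+1%:R * y ^+ q * (x i - y)) =
   y ^+ q.+1 + q%:R * y ^+ q.+1 * (1 - \sum_i d i).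
  rewrite (eq_bigr (fun i => d i * (y ^+ q.+1 - q.+1%:R * y ^+ q.+1) +
      d i * x i * (q.+1%:R * y ^+ q))) => [|i _]; last by rewrite exprS; ring.
  by rewrite big_split /= -!mulr_suml -/y -natr1 exprS; ring.
by rewrite lerDl !mulr_ge0 ?exprn_ge0 ?subr_ge0.
Qed.

(** Averaging by a doubly substochastic matrix decreases lp norms: the row sums
    allow Jensen's inequality, and the column sums bound the total weight that
    each [`|g i| ^+ q.+1] receives. *)
Lemma lp_norm_substochastic p r l (D : 'I_l -> 'I_r -> R) f g :
  p != Some 0 -> (forall j i, 0 <= D j i) ->
  (forall j, \sum_i D j i <= 1) -> (forall i, \sum_j D j i <= 1) ->
  (forall j, `|f j| <= \sum_i D j i * `|g i|) -> lp_norm p f <= lp_norm p g.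
Proof.
move=> p0 D0 row1 col1 fg; case: p p0 => [[//|q]|] _; last first.
  apply: lp_norm_infty_leP => [|j]; first exact: lp_norm_ge0.
  apply: (le_trans (fg j)).
  apply: (@le_trans _ _ (\sum_i D j i * lp_norm None g)).
    by apply: ler_sum => i _; rewrite ler_wpM2l// le_lp_norm_infty.
  by rewrite -mulr_suml ler_piMl// lp_norm_ge0.
rewrite lp_norm_leP ?lp_norm_ge0// lp_norm_expr.
apply: (@le_trans _ _ (\sum_j \sum_i D j i * `|g i| ^+ q.+1)).
  apply: ler_sum => j _; apply: le_trans (expr_substochastic_mean _ _ _ _) => //.
  by rewrite ler_pXn2r ?nnegrE// (le_trans _ (fg j)).
rewrite exchange_big /=; apply: ler_sum => i _.
by rewrite -mulr_suml ler_piMl// exprn_ge0.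
Qed.

Lemma lp_normZ_le p r c (f : 'I_r -> R) : p != Some 0 -> 0 <= c ->
  lp_norm p (fun i => c * f i) <= c * lp_norm p f.
Proof.
case: p => [[//|q]|] _ c0; last first.
  apply: lp_norm_infty_leP => [|j]; first by rewrite mulr_ge0 ?lp_norm_ge0.
  by rewrite normrM (ger0_norm c0) ler_wpM2l// le_lp_norm_infty.
rewrite lp_norm_leP ?mulr_ge0 ?lp_norm_ge0// exprMn lp_norm_expr mulr_sumr.
by apply: ler_sum => i _; rewrite normrM (ger0_norm c0) exprMn.
Qed.

(** Convexity for the weights [a / (a + b)] and [b / (a + b)] at the points
    [x / a] and [y / b], cleared of denominators. *)
Lemma expr_convex2 q (a b x y : R) : 0 < a -> 0 < b -> 0 <= x -> 0 <= y ->
  (x + y) ^+ q.+1 <=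
  (a + b) ^+ q * (a * (x / a) ^+ q.+1 + b * (y / b) ^+ q.+1).
Proof.
move=> a0 b0 x0 y0; pose z := (x + y) / (a + b).
have z0 : 0 <= z by rewrite divr_ge0 ?addr_ge0// ltW.
have := ler_wpM2l (ltW a0) (tangent_le_expr q (divr_ge0 x0 (ltW a0)) z0).
have := ler_wpM2l (ltW b0) (tangent_le_expr q (divr_ge0 y0 (ltW b0)) z0).
move=> hb ha; have := lerD ha hb.
have ab0 : a + b != 0 by rewrite gt_eqF// addr_gt0.
set w := q.+1%:R * z ^+ q.
have -> : a * (z ^+ q.+1 + w * (x / a - z)) + b * (z ^+ q.+1 + w * (y / b - z)) =
    (a + b) * z ^+ q.+1.
  have -> : a * (z ^+ q.+1 + w * (x / a - z)) + b * (z ^+ q.+1 + w * (y / b - z))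
    = (a + b) * z ^+ q.+1 + w * (x + y - (a + b) * z).
    by field; rewrite ?gt_eqF.
  by rewrite /z mulrCA divff// mulr1 subrr mulr0 addr0.
move=> /(ler_wpM2l (exprn_ge0 q (ltW (addr_gt0 a0 b0)))).
by rewrite mulrA -exprSr -exprMn /z mulrCA divff// mulr1.
Qed.

(** Minkowski's inequality.  For finite exponents, [f] and [g] are normalised by
    numbers [a] and [b] slightly above their norms, so that no division by zero
    occurs when one of them vanishes. *)
Lemma lp_normD p r (f g : 'I_r -> R) : p != Some 0 ->
  lp_norm p (fun i => f i + g i) <= lp_norm p f + lp_norm p g.
Proof.
case: p => [[//|q]|] _; last first.
  apply: lp_norm_infty_leP => [|j]; first by rewrite addr_ge0 ?lp_norm_ge0.
  by rewrite (le_trans (ler_normD _ _))// lerD// le_lp_norm_infty.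
apply/ler_addgt0Pr => e e0; set F := lp_norm _ f; set G := lp_norm _ g.
have F0 : 0 <= F by exact: lp_norm_ge0.
have G0 : 0 <= G by exact: lp_norm_ge0.
pose a := F + e / 2; pose b := G + e / 2.
have a0 : 0 < a by rewrite ltr_wpDl// divr_gt0.
have b0 : 0 < b by rewrite ltr_wpDl// divr_gt0.
rewrite (_ : F + G + e = a + b); last by rewrite /a /b; field.
have below h c : 0 < c -> lp_norm (Some q.+1) h <= c ->
    \sum_(i < r) c * (`|h i| / c) ^+ q.+1 <= c.
  move=> c0; rewrite lp_norm_leP ?(ltW c0)// => hc.
  rewrite -mulr_sumr ger_pMr//; under eq_bigr do rewrite expr_div_n.
  by rewrite -mulr_suml ler_pdivrMr ?exprn_gt0// mul1r.
have ab0 : 0 <= a + b by exact: ltW (addr_gt0 a0 b0).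
rewrite lp_norm_leP//.
apply: (@le_trans _ _ (\sum_i (a + b) ^+ q *
    (a * (`|f i| / a) ^+ q.+1 + b * (`|g i| / b) ^+ q.+1))).
  apply: ler_sum => i _; apply: le_trans (expr_convex2 q a0 b0 _ _) => //.
  by rewrite ler_pXn2r ?nnegrE ?addr_ge0// ler_normD.
rewrite -mulr_sumr [leRHS]exprSr ler_wpM2l ?exprn_ge0//.
rewrite big_split /= lerD//; apply: below => //.
- by rewrite /a lerDl divr_ge0// ltW.
- by rewrite /b lerDl divr_ge0// ltW.
Qed.

End LpNorm.

(** * Contractions *)

Section Contractions.
Set Implicit Arguments.
Unset Strict Implicit.
Variable R : realType.

Definition sqnorm n (u : 'rV[R]_n) : R := (u *m u^T) 0 0.

Lemma sqnormE n (u : 'rV[R]_n) : sqnorm u = \sum_i u 0 i ^+ 2.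
Proof. by rewrite /sqnorm mxE; apply: eq_bigr => i _; rewrite mxE expr2. Qed.

Lemma sqnorm_ge0 n (u : 'rV[R]_n) : 0 <= sqnorm u.
Proof. by rewrite sqnormE sumr_ge0// => i _; rewrite sqr_ge0. Qed.

Lemma sqnorm_eq0 n (u : 'rV[R]_n) : sqnorm u = 0 -> u = 0.
Proof.
rewrite sqnormE => /eqP; rewrite psumr_eq0 => [|i _]; last exact: sqr_ge0.
move=> /allP h; apply/rowP => i; rewrite mxE.
by apply/eqP; have := h i (mem_index_enum i); rewrite /= sqrf_eq0.
Qed.

Lemma gram_eq0 m n (B : 'M[R]_(m, n)) : B^T *m B = 0 -> B = 0.
Proof.
move=> BB; apply/matrixP => i j; rewrite mxE.
have /rowP/(_ i) : row j B^T = 0.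
  apply: sqnorm_eq0; rewrite /sqnorm rowE trmx_mul trmxK mulmxA.
  by rewrite -(mulmxA _ B^T) BB mulmx0 mul0mx mxE.
by rewrite !mxE.
Qed.

Lemma sqnormB n (u v : 'rV[R]_n) :
  sqnorm (u - v) = sqnorm u - 2 * (u *m v^T) 0 0 + sqnorm v.
Proof.
rewrite !sqnormE mxE mulr_sumr -sumrB -big_split /=.
by apply: eq_bigr => i _; rewrite !mxE; ring.
Qed.

(** Vectors are rows, acted on from the right; by [contraction_tr] the condition
    on columns is equivalent. *)
Definition mx_contraction m n (L : 'M[R]_(m, n)) : Prop :=
  forall x : 'rV[R]_m, sqnorm (x *m L) <= sqnorm x.

Lemma contractionM m n l (L : 'M[R]_(m, n)) (N : 'M[R]_(n, l)) :
  mx_contraction L -> mx_contraction N -> mx_contraction (L *m N).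
Proof.
by move=> cL cN x; rewrite mulmxA; apply: le_trans (cN _) (cL x).
Qed.

(** With [y = x *m L^T], the squared norm of [y] is the inner product of [x] and
    [y *m L], hence at most the mean of their squared norms; and [y *m L] is no
    longer than [y]. *)
Lemma contraction_tr m n (L : 'M[R]_(m, n)) :
  mx_contraction L -> mx_contraction L^T.
Proof.
move=> cL x; set y := x *m L^T.
have yE : (y *m L *m x^T) 0 0 = sqnorm y.
  by rewrite /sqnorm {3}/y trmx_mul trmxK mulmxA.
have := sqnorm_ge0 (y *m L - x); rewrite sqnormB yE.
have := cL y; lra.
Qed.

(** The squared norm of [x *m L] is the one of [x *m Q] for the projector
    [Q = L *m L^T], and the deficit is the squared norm of [x - x *m Q]. *)
Lemma partial_isometry_contraction m n (L : 'M[R]_(m, n)) :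
  is_orthogonal_projector (L *m L^T) -> mx_contraction L.
Proof.
set Q := L *m L^T => -[QQ QT] x; rewrite -subr_ge0.
have -> : sqnorm x - sqnorm (x *m L) = sqnorm (x - x *m Q).
  have QE : (x *m (x *m Q)^T) 0 0 = sqnorm (x *m L).
    by rewrite /sqnorm (trmx_mul x Q) QT (trmx_mul x L) /Q !mulmxA.
  have QQE : sqnorm (x *m Q) = sqnorm (x *m L).
    by rewrite -QE /sqnorm (trmx_mul x Q) QT -mulmxA (mulmxA Q) QQ.
  by rewrite sqnormB QE QQE; ring.
exact: sqnorm_ge0.
Qed.

Lemma projector1 n : is_orthogonal_projector (1%:M : 'M[R]_n).
Proof. by split; rewrite ?mulmx1 ?trmx1. Qed.

Lemma isometry_contraction m n (L : 'M[R]_(m, n)) :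
  L^T *m L = 1%:M -> mx_contraction L.
Proof.
move=> LL; rewrite -(trmxK L); apply/contraction_tr/partial_isometry_contraction.
by rewrite trmxK LL; exact: projector1.
Qed.

Lemma projector_contraction m (Q : 'M[R]_m) :
  is_orthogonal_projector Q -> mx_contraction Q.
Proof.
by move=> [QQ QT]; apply: partial_isometry_contraction; rewrite QT QQ.
Qed.

Lemma projectorC m (Q : 'M[R]_m) :
  is_orthogonal_projector Q -> is_orthogonal_projector (1%:M - Q).
Proof.
move=> [QQ QT]; split; last by rewrite linearB /= trmx1 QT.
by rewrite mulmxBl mul1mx mulmxBr mulmx1 QQ subrr subr0.
Qed.

Lemma diag_contraction n (d : 'rV[R]_n) :
  (forall i, `|d 0 i| <= 1) -> mx_contraction (diag_mx d).
Proof.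
move=> d1 x; rewrite !sqnormE; apply: ler_sum => i _.
rewrite mul_mx_diag mxE exprMn ler_piMr ?sqr_ge0//.
by rewrite -real_normK ?num_real// exprn_ile1.
Qed.

Lemma contraction_row m n (L : 'M[R]_(m, n)) i :
  mx_contraction L -> \sum_j L i j ^+ 2 <= 1.
Proof.
move=> /(_ (delta_mx 0 i)); rewrite -rowE /sqnorm trmx_delta mul_delta_mx.
rewrite [leRHS]mxE eqxx -/(sqnorm _) sqnormE.
by under eq_bigr do rewrite mxE.
Qed.

Lemma contraction_col m n (L : 'M[R]_(m, n)) j :
  mx_contraction L -> \sum_i L i j ^+ 2 <= 1.
Proof.
move=> /contraction_tr/(contraction_row j).
by under eq_bigr do rewrite mxE.
Qed.

End Contractions.

(** * Schatten norms as lp norms of compressed diagonals *)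

Section Schatten.
Set Implicit Arguments.
Unset Strict Implicit.
Variable R : realType.

Lemma svd_singular_values m n (A : 'M[R]_(m, n)) U s V :
  is_svd A U s V -> singular_values A = s.
Proof.
by have [U' [V' A_svd']] := singular_valuesP A; apply: svd_unique A_svd'.
Qed.

Lemma size_singular_values m n (A : 'M[R]_(m, n)) :
  size (singular_values A) = minn m n.
Proof. by have [U [V /svd_size]] := singular_valuesP A. Qed.

Lemma singular_values_nth_ge0 m n (A : 'M[R]_(m, n)) i :
  0 <= (singular_values A)`_i.
Proof.
have [U [V /svd_ge0 s0]] := singular_valuesP A.
have [si|si] := ltnP i (size (singular_values A)); last by rewrite nth_default.
by rewrite s0// mem_nth.
Qed.

Lemma singular_values_nth_le m n (A : 'M[R]_(m, n)) i j : (i <= j)%N ->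
  (singular_values A)`_j <= (singular_values A)`_i.
Proof.
move=> ij; have [U [V /svd_sorted ss]] := singular_valuesP A.
have [sj|sj] := ltnP j (size (singular_values A)); last first.
  by rewrite (nth_default _ sj) singular_values_nth_ge0.
apply: (sorted_leq_nth _ _ 0 ss) => //.
- by move=> x y z xy yz; apply: le_trans yz xy.
- by move=> x; apply: lexx.
- by rewrite inE (leq_ltn_trans ij).
Qed.

Lemma schatten_norm_lp p m n (A : 'M[R]_(m, n)) :
  schatten_norm p A =
  lp_norm p (fun i : 'I_(minn m n) => (singular_values A)`_i).
Proof.
case: p => [q|] /=.
  rewrite (big_nth 0) size_singular_values big_mkord; congr (_ `^ _).
  by apply: eq_bigr => i _; rewrite ger0_norm// singular_values_nth_ge0.
rewrite /spectral_norm /singular_value /=; apply/le_anti/andP; split; last first.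
  apply: bigmax_le => [|i _]; first exact: singular_values_nth_ge0.
  by rewrite ger0_norm ?singular_values_nth_ge0// singular_values_nth_le.
have [r0|r0] := posnP (minn m n).
  by rewrite nth_default ?bigmax_ge_id// size_singular_values r0.
apply: le_trans (le_bigmax 0 _ (Ordinal r0)).
by rewrite ger0_norm ?singular_values_nth_ge0.
Qed.

Lemma leading_cols_isometry m k (U : 'M[R]_m) : (k <= m)%N ->
  U^T *m U = 1%:M -> (leading_cols k U)^T *m leading_cols k U = 1%:M.
Proof.
move=> km UU; rewrite /leading_cols trmx_mul mulmxA -(mulmxA _ U^T) UU mulmx1.
by rewrite tr_pid_mx mul_pid_mx !minnn (minn_idPr km) pid_mx_1.
Qed.

Lemma mulmx_pid n k l (M : 'M[R]_(l, n)) (kn : (k <= n)%N) :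
  M *m (pid_mx k : 'M[R]_(n, k)) = \matrix_(i, j) M i (widen_ord kn j).
Proof.
apply/matrixP => i j; rewrite !mxE (bigD1 (widen_ord kn j))//= big1 => [|x xj].
  by rewrite mxE /= eqxx ltn_ord mulr1 addr0.
by rewrite mxE; move: xj; rewrite -val_eqE => /negPf /= ->; rewrite mulr0.
Qed.

(** [A V_k = U_k Sigma_k], because the other right singular vectors are
    orthogonal to the columns of [V_k]. *)
Lemma svd_leading_cols m n k (A : 'M[R]_(m, n)) U s V :
  (k <= minn m n)%N -> is_svd A U s V ->
  A *m leading_cols k V = leading_cols k U *m diag_mx (\row_(j < k) s`_j).
Proof.
rewrite leq_min => /andP[km kn] [UU VV _ _ _ ->].
rewrite /leading_cols !mulmxA -(mulmxA _ V^T) VV mulmx1 -!mulmxA; congr (_ *m _).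
rewrite (mulmx_pid _ kn) mul_mx_diag; apply/matrixP => i j; rewrite !mxE /=.
by case: eqVneq => [->|]; rewrite ?ltn_ord ?mul1r ?mul0r ?mulr1n ?mulr0n.
Qed.

Lemma svd_thin m n (A : 'M[R]_(m, n)) U s V :
  is_svd A U s V -> A = truncated_svd U s V (minn m n).
Proof.
move=> A_svd; rewrite /truncated_svd -(svd_leading_cols (leqnn _) A_svd).
case: A_svd => _ VV sz _ _ ->.
rewrite /leading_cols trmx_mul !mulmxA -(mulmxA _ V^T) VV mulmx1.
congr (_ *m _); rewrite -!mulmxA; congr (_ *m _).
rewrite tr_pid_mx mul_pid_mx !minnn.
apply/matrixP => i j; rewrite !mxE (bigD1 j)//= big1 => [|x xj].
  rewrite !mxE eqxx /=; case: ltnP => [_|]; first by rewrite mulr1 addr0.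
  rewrite mulr0 addr0.
  (* columns of index at least [minn m n] hold no singular value: [s] is too short *)
  case: eqVneq => [ij|]; last by rewrite mulr0n.
  by rewrite ij => jr; rewrite nth_default ?sz// mulr1n.
by rewrite !mxE; move: xj; rewrite -val_eqE => /negPf /= ->; rewrite mulr0.
Qed.

(** With [lp_norm_compression_le], this makes the Schatten norm of [A] the maximum
    of the lp norms of the diagonals of [L *m A *m N] over contractions [L] and
    [N], for exponents at least 1.  This variational form is convenient because it is linear in [A]; the
    maximum is reached at [L = U^T] and [N = V], truncated to square size. *)
Lemma schatten_norm_attained m n (A : 'M[R]_(m, n)) :
  exists (L : 'M[R]_(minn m n, m)) (N : 'M[R]_(n, minn m n)),
  [/\ mx_contraction L, mx_contraction N &
  forall p, schatten_norm p A = lp_norm p (fun i => (L *m A *m N) i i)].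
Proof.
have [U [V A_svd]] := singular_valuesP A.
have EE := leading_cols_isometry (geq_minl m n) (svd_left_orthogonal A_svd).
have FF := leading_cols_isometry (geq_minr m n) (svd_right_orthogonal A_svd).
exists (leading_cols (minn m n) U)^T, (leading_cols (minn m n) V); split.
- exact/contraction_tr/isometry_contraction.
- exact: isometry_contraction.
move=> p; rewrite schatten_norm_lp; apply: eq_lp_norm => i.
by rewrite -mulmxA (svd_leading_cols _ A_svd)// mulmxA EE mul1mx !mxE eqxx mulr1n.
Qed.

(** If [X] and [Y] are the products of [L] and [N] with the singular vectors,
    entry [j] of the diagonal is the sum over [i] of [X j i * sigma_i * Y i j],
    and [`|X j i * Y i j|] is at most the mean of the squares of [X j i] and
    [Y i j].  Since the rows and columns of contractions have norm at most 1,
    these means form a doubly substochastic matrix. *)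
Lemma lp_norm_compression_le p m n r (A : 'M[R]_(m, n)) (L : 'M[R]_(r, m))
    (N : 'M[R]_(n, r)) :
  p != Some 0 -> mx_contraction L -> mx_contraction N ->
  lp_norm p (fun i => (L *m A *m N) i i) <= schatten_norm p A.
Proof.
move=> p0 cL cN; have [U [V A_svd]] := singular_valuesP A.
have EE := leading_cols_isometry (geq_minl m n) (svd_left_orthogonal A_svd).
have FF := leading_cols_isometry (geq_minr m n) (svd_right_orthogonal A_svd).
rewrite schatten_norm_lp.
have cX := contractionM cL (isometry_contraction EE).
have cY := contractionM (contraction_tr (isometry_contraction FF)) cN.
set X := _ *m _ in cX; set Y := _ *m _ in cY.
have LAN : L *m A *m N = X *m diag_mx (\row_j (singular_values A)`_j) *m Y.
  by rewrite {1}(svd_thin A_svd) /truncated_svd /X /Y !mulmxA.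
clearbody X Y.
apply: (@lp_norm_substochastic _ _ _ _
    (fun j i => (X j i ^+ 2 + Y i j ^+ 2) / 2)) => //.
- by move=> j i; rewrite divr_ge0// addr_ge0// sqr_ge0.
- move=> j; rewrite -mulr_suml ler_pdivrMr// mul1r big_split /=.
  by rewrite (natrD _ 1 1) lerD// ?contraction_row ?contraction_col.
- move=> j; rewrite -mulr_suml ler_pdivrMr// mul1r big_split /=.
  by rewrite (natrD _ 1 1) lerD// ?contraction_row ?contraction_col.
move=> j; rewrite LAN mxE; apply: (le_trans (ler_norm_sum _ _ _)).
apply: ler_sum => i _; rewrite mul_mx_diag !mxE !normrM mulrAC.
apply: ler_wpM2r => //; rewrite ler_pdivlMr//.
rewrite -(real_normK (num_real (X j i))) -(real_normK (num_real (Y i j))).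
have := sqr_ge0 (`|X j i| - `|Y i j|); rewrite sqrrB; lra.
Qed.

(** Compressing [L *m A *m N] to a diagonal by contractions also compresses [A],
    because contractions compose. *)
Lemma schatten_norm_ideal p m n m' n' (A : 'M[R]_(m, n)) (L : 'M[R]_(m', m))
    (N : 'M[R]_(n, n')) :
  p != Some 0 -> mx_contraction L -> mx_contraction N ->
  schatten_norm p (L *m A *m N) <= schatten_norm p A.
Proof.
move=> p0 cL cN.
have [L' [N' [cL' cN' ->]]] := schatten_norm_attained (L *m A *m N).
have := lp_norm_compression_le A p0 (contractionM cL' cL) (contractionM cN cN').
by apply: le_trans; apply: eq_lp_norm_le => i; rewrite !mulmxA.
Qed.

(** The diagonal of a compression is additive, so that the triangle inequality
    reduces to Minkowski's inequality on the compression attaining the norm of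
    [A + B]. *)
Lemma schatten_normD p m n (A B : 'M[R]_(m, n)) : p != Some 0 ->
  schatten_norm p (A + B) <= schatten_norm p A + schatten_norm p B.
Proof.
move=> p0; have [L [N [cL cN ->]]] := schatten_norm_attained (A + B).
have cA := lp_norm_compression_le A p0 cL cN.
have cB := lp_norm_compression_le B p0 cL cN.
apply: le_trans (lerD cA cB); apply: le_trans (lp_normD _ _ p0).
by apply: eq_lp_norm_le => i; rewrite mulmxDr mulmxDl mxE.
Qed.

Lemma schatten_normZ_le p m n c (A : 'M[R]_(m, n)) : p != Some 0 -> 0 <= c ->
  schatten_norm p (c *: A) <= c * schatten_norm p A.
Proof.
move=> p0 c0; have [L [N [cL cN ->]]] := schatten_norm_attained (c *: A).
apply: le_trans (ler_wpM2l c0 (lp_norm_compression_le A p0 cL cN)).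
apply: le_trans (lp_normZ_le _ p0 c0).
by apply: eq_lp_norm_le => i; rewrite -scalemxAr -scalemxAl mxE.
Qed.

Lemma schatten_normZ p m n c (A : 'M[R]_(m, n)) : p != Some 0 -> 0 < c ->
  schatten_norm p (c *: A) = c * schatten_norm p A.
Proof.
move=> p0 c0; apply/le_anti/andP; split.
  exact: schatten_normZ_le (ltW c0).
rewrite -ler_pdivlMl//; have c'0 : 0 <= c^-1 by rewrite invr_ge0 ltW.
have := schatten_normZ_le (c *: A) p0 c'0.
by rewrite scalerA mulVf ?scale1r ?gt_eqF.
Qed.

End Schatten.

(** * Gram matrices and principal angles *)

Section Gram.
Set Implicit Arguments.
Unset Strict Implicit.
Variable R : realType.

Lemma schatten_normMl_le p l m n (L : 'M[R]_(l, m)) (A : 'M[R]_(m, n)) :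
  p != Some 0 -> mx_contraction L ->
  schatten_norm p (L *m A) <= schatten_norm p A.
Proof.
move=> p0 cL; rewrite -[L *m A]mulmx1; apply: schatten_norm_ideal => //.
exact: projector_contraction (projector1 _ _).
Qed.

Lemma schatten_normMr_le p m n l (A : 'M[R]_(m, n)) (N : 'M[R]_(n, l)) :
  p != Some 0 -> mx_contraction N ->
  schatten_norm p (A *m N) <= schatten_norm p A.
Proof.
move=> p0 cN; rewrite -[A *m N]mul1mx mulmxA; apply: schatten_norm_ideal => //.
exact: projector_contraction (projector1 _ _).
Qed.

(** Douglas factorisation: equal Gram matrices make [B] factor as [L *m S] with
    [L = B S^+], and [L^T L = S S^+] is a projector, so that [L] is a
    contraction.  The Gram matrix thus determines the norm, and matrices with
    different numbers of rows compare without matching their lists of singular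
    values. *)
Lemma schatten_norm_gram_le p m l n (B : 'M[R]_(m, n)) (S : 'M[R]_(l, n)) :
  p != Some 0 -> B^T *m B = S^T *m S -> schatten_norm p B <= schatten_norm p S.
Proof.
move=> p0 BS; have [SXS XSX SXT XST] := moore_penroseP S.
set X := moore_penrose S in SXS XSX SXT XST.
have BXS : B *m X *m S = B.
  apply/eqP; rewrite -subr_eq0; apply/eqP/gram_eq0.
  have -> : B *m X *m S - B = B *m (X *m S - 1%:M).
    by rewrite mulmxBr mulmx1 mulmxA.
  rewrite trmx_mul mulmxA -(mulmxA _ B^T) BS -!mulmxA.
  by rewrite (mulmxBr S) mulmx1 (mulmxA S) SXS subrr !mulmx0.
rewrite -{1}BXS; apply: schatten_normMl_le => //.
rewrite -(trmxK (B *m X)); apply/contraction_tr/partial_isometry_contraction.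
have -> : (B *m X)^T *m (B *m X)^T^T = S *m X.
  rewrite trmxK trmx_mul mulmxA -(mulmxA _ B^T) BS mulmxA -(mulmxA _ S).
  by rewrite -trmx_mul SXT mulmxA SXS.
by split => //; rewrite mulmxA SXS.
Qed.

Lemma schatten_norm_gram p m l n (B : 'M[R]_(m, n)) (S : 'M[R]_(l, n)) :
  p != Some 0 -> B^T *m B = S^T *m S -> schatten_norm p B = schatten_norm p S.
Proof.
by move=> p0 BS; apply/le_anti; rewrite !schatten_norm_gram_le.
Qed.

Lemma range_basis_projector m (P : 'M[R]_m) : is_orthogonal_projector P ->
  range_basis P *m (range_basis P)^T = P.
Proof.
move=> [PP PT]; have [ZZ /andP[/submxP[X ZX] /submxP[Y PY]]] := range_basisP P.
set Z := range_basis P in ZZ ZX PY *.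
have PZ : P *m Z = Z.
  by rewrite -[Z]trmxK ZX trmx_mul trmxK mulmxA PP.
have ZZP : Z *m Z^T *m P = P.
  have PE : P = Z *m Y^T by rewrite -(trmxK Z) -trmx_mul -PY trmxK.
  have : Z *m Z^T *m (Z *m Y^T) = Z *m Y^T.
    by rewrite mulmxA -(mulmxA Z) ZZ mulmx1.
  by rewrite -PE.
have := congr1 trmx ZZP; rewrite !trmx_mul trmxK PT => PZZ.
by rewrite -[RHS]PZZ mulmxA PZ.
Qed.

(** Let [Y] and [Z] be the bases of [Q] and [P], and [Z^T Y = E S F^T] the thin
    singular value decomposition, [S] being the diagonal of the cosines.  Then
    [(1 - P) Y] has Gram matrix [1 - (Z^T Y)^T (Z^T Y) = F (1 - S^2) F^T], which
    is also the Gram matrix of [T F^T], where [T] is the diagonal of the sines.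
    The rank hypothesis makes [F] square, that is orthogonal. *)
Lemma sin_Theta_norm p m (P Q : 'M[R]_m) : p != Some 0 ->
  is_orthogonal_projector P -> (\rank Q <= \rank P)%N ->
  schatten_norm p (sin_Theta P Q) =
  schatten_norm p ((1%:M - P) *m range_basis Q).
Proof.
move=> p0 P_proj QP; have [KK KT] := projectorC P_proj.
have [YY _] := range_basisP Q.
have ZZ := range_basis_projector P_proj.
rewrite /sin_Theta /principal_angle /singular_value /=.
set Z := range_basis P in ZZ *; set Y := range_basis Q in YY *.
set C := Z^T *m Y; set B := _ *m Y.
have [U [V C_svd]] := singular_valuesP C.
set s := singular_values C in C_svd *.
pose c := minn (\rank P) (\rank Q).
pose F := leading_cols c V; pose E := leading_cols c U.
pose S := diag_mx (\row_(j < c) s`_j).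
have EE : E^T *m E = 1%:M.
  exact: leading_cols_isometry (geq_minl _ _) (svd_left_orthogonal C_svd).
have FF : F^T *m F = 1%:M.
  exact: leading_cols_isometry (geq_minr _ _) (svd_right_orthogonal C_svd).
have FF' : F *m F^T = 1%:M.
  rewrite /F /leading_cols trmx_mul mulmxA -(mulmxA V) tr_pid_mx mul_pid_mx.
  rewrite !minnn /c (minn_idPr QP) pid_mx_1 mulmx1.
  exact: mulmx1C (svd_right_orthogonal C_svd).
have CE : C = E *m S *m F^T by exact: svd_thin C_svd.
clearbody E F.
have CC : C^T *m C = F *m (S *m S) *m F^T.
  by rewrite CE !trmx_mul trmxK tr_diag_mx !mulmxA -(mulmxA _ E^T) EE mulmx1.
have BB : B^T *m B = 1%:M - C^T *m C.
  rewrite /B trmx_mul KT mulmxA -(mulmxA Y^T) KK mulmxBr mulmxBl mulmx1 YY.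
  by rewrite /C trmx_mul trmxK mulmxA -(mulmxA _ Z) ZZ.
have BF : (B *m F)^T *m (B *m F) = 1%:M - S *m S.
  rewrite trmx_mul mulmxA -(mulmxA _ B^T) BB CC mulmxBr mulmx1 mulmxBl FF.
  by rewrite !mulmxA FF mul1mx -!mulmxA FF mulmx1.
have s1 (j : 'I_c) : -1 <= s`_j <= 1.
  rewrite -ler_norml -(@ler_pXn2r _ 2)// ?nnegrE// expr1n real_normK ?num_real//.
  rewrite -subr_ge0.
  have -> : 1 - s`_j ^+ 2 = ((B *m F)^T *m (B *m F)) j j.
    by rewrite BF mul_diag_mx !mxE eqxx !mulr1n expr2.
  by rewrite mxE; apply: sumr_ge0 => i _; rewrite mxE -expr2 sqr_ge0.
set T := diag_mx _.
have TT : T *m T = 1%:M - S *m S.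
  rewrite !mul_diag_mx; apply/matrixP => i j; rewrite !mxE.
  case: eqVneq => [->|_]; last by rewrite !mulr0n !mulr0 subr0.
  rewrite !mulr1n sin_acos// -expr2 sqr_sqrtr// subr_ge0 expr2.
  by have := s1 j; nra.
have -> : schatten_norm p B = schatten_norm p (T *m F^T).
  apply: schatten_norm_gram => //.
  rewrite (trmx_mul T) trmxK tr_diag_mx mulmxA -(mulmxA F T) TT BB CC.
  by rewrite mulmxBr mulmxBl mulmx1 FF' !mulmxA.
apply/le_anti/andP; split; last first.
  by apply: schatten_normMr_le => //; exact/contraction_tr/isometry_contraction.
rewrite -{1}[T]mulmx1 -FF mulmxA; apply: schatten_normMr_le => //.
exact: isometry_contraction.
Qed.

Lemma truncated_svd_moore_penrose m n k (U : 'M[R]_m) s (V : 'M[R]_n) :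
  (k <= minn m n)%N -> U^T *m U = 1%:M -> V^T *m V = 1%:M ->
  (forall i : 'I_k, s`_i != 0) ->
  moore_penrose (truncated_svd U s V k) =
  leading_cols k V *m diag_mx (\row_(j < k) (s`_j)^-1) *m (leading_cols k U)^T.
Proof.
rewrite leq_min => /andP[km kn] UU VV s0.
have EE := leading_cols_isometry km UU; have FF := leading_cols_isometry kn VV.
apply: moore_penrose_unique (moore_penroseP _) _; rewrite /truncated_svd.
set E := leading_cols k U in EE *; set F := leading_cols k V in FF *.
clearbody E F; set G := diag_mx _; set H := diag_mx _.
have GH : G *m H = 1%:M.
  rewrite mul_diag_mx; apply/matrixP => i j; rewrite !mxE.
  by case: eqVneq => [->|_]; rewrite ?mulr1n ?mulr0n ?mulr0// divff.
have HG := mulmx1C GH.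
have AX : E *m G *m F^T *m (F *m H *m E^T) = E *m E^T.
  by rewrite !mulmxA -(mulmxA _ F^T) FF mulmx1 -(mulmxA E) GH mulmx1.
have XA : F *m H *m E^T *m (E *m G *m F^T) = F *m F^T.
  by rewrite !mulmxA -(mulmxA _ E^T) EE mulmx1 -(mulmxA F) HG mulmx1.
split; rewrite ?AX ?XA.
- by rewrite !mulmxA -(mulmxA E) EE mulmx1.
- by rewrite !mulmxA -(mulmxA F) FF mulmx1.
- by rewrite trmx_mul trmxK.
- by rewrite trmx_mul trmxK.
Qed.

End Gram.

(** * The sine theorem for low-rank approximation *)

Theorem theorem6 (R : realType) (m n k : nat) (A : 'M[R]_(m, n))
    (U : 'M[R]_m) (s : seq R) (V : 'M[R]_n) (P : 'M[R]_m) (p : option nat)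
    (k_gt0 : (0 < k)%N) (k_ltr : (k < minn m n)%N)
    (A_svd : is_svd A U s V)
    (gap : singular_value A k.+1 < singular_value A k)
    (P_proj : is_orthogonal_projector P)
    (k_le_rank : (k <= \rank P)%N) (rank_lt : (\rank P < m - k)%N)
    (p_ge1 : p != Some 0%N) :
  let Ak := truncated_svd U s V k in
  let Pk := Ak *m moore_penrose Ak in
  singular_value A k * schatten_norm p (sin_Theta P Pk)
    <= schatten_norm p ((1%:M - P) *m A) /\
  schatten_norm p ((1%:M - P) *m A)
    <= spectral_norm A * schatten_norm p (sin_Theta P Pk)
       + schatten_norm p (A - Ak).
Proof.
move=> Ak Pk.
have sE := svd_singular_values A_svd.
have [UU VV _ _ _ _] := A_svd.
have kr := ltnW k_ltr; have := kr; rewrite leq_min => /andP[km kn].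
have EE := leading_cols_isometry km UU.
have FF := leading_cols_isometry kn VV.
set a := singular_value A k; set b := spectral_norm A.
have s_ge0 i : 0 <= s`_i by rewrite -sE singular_values_nth_ge0.
have a0 : 0 < a.
  by apply: le_lt_trans gap; rewrite /singular_value sE; exact: s_ge0.
have as_le (i : 'I_k) : a <= s`_i.
  by rewrite /a /singular_value -sE singular_values_nth_le// -ltnS prednK.
have sb i : s`_i <= b.
  by rewrite /b /spectral_norm /singular_value -sE singular_values_nth_le.
have s0 (i : 'I_k) : 0 < s`_i by apply: lt_le_trans (as_le i).
have b0 : 0 < b by apply: lt_le_trans (s0 (Ordinal k_gt0)) (sb _).
have AF := svd_leading_cols kr A_svd.
have PkX : Pk = Ak *m moore_penrose Ak by [].
rewrite /Ak truncated_svd_moore_penrose// in PkX; last first.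
  by move=> i; rewrite gt_eqF.
have AkE : Ak =
    leading_cols k U *m diag_mx (\row_j s`_j) *m (leading_cols k V)^T by [].
have cE := isometry_contraction EE; have cF := isometry_contraction FF.
rewrite /truncated_svd in PkX.
set E := leading_cols k U in EE PkX AF cE AkE.
set F := leading_cols k V in FF PkX AF cF AkE.
clearbody Ak Pk E F.
have PkE : Pk = E *m E^T.
  rewrite PkX !mulmxA -(mulmxA _ F^T) FF mulmx1; congr (_ *m _).
  rewrite -[RHS]mulmx1 -!mulmxA; congr (_ *m _).
  rewrite mul_diag_mx; apply/matrixP => i j; rewrite !mxE.
  by case: eqVneq => [->|_]; rewrite ?mulr1n ?mulr0n ?mulr0// divff ?gt_eqF.
have Pk_proj : is_orthogonal_projector Pk.
  rewrite PkE; split; last by rewrite trmx_mul trmxK.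
  by rewrite mulmxA -(mulmxA _ E^T) EE mulmx1.
have rank_Pk : (\rank Pk <= \rank P)%N.
  rewrite PkE; apply: leq_trans k_le_rank.
  by apply: leq_trans (mxrankM_maxl _ _) (rank_leq_col _).
rewrite sin_Theta_norm//.
have YY := range_basis_projector Pk_proj.
have [Y1 _] := range_basisP Pk.
(* the number of columns of [Y] mentions [Pk], which blocks rewriting [Pk] *)
move: (range_basis Pk) YY Y1; move: (\rank Pk) => r Y YY Y1.
have cY : mx_contraction Y by exact: isometry_contraction.
set K := 1%:M - P.
split.
  (* [sigma_k (1 - P) Y = (1 - P) A V_k (sigma_k Sigma_k^-1) U_k^T Y] *)
  rewrite -schatten_normZ//.
  pose N := F *m diag_mx (\row_(j < k) (a / s`_j)) *m E^T *m Y.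
  have -> : a *: (K *m Y) = K *m A *m N.
    have YE : Y = E *m E^T *m Y by rewrite -PkE -YY -mulmxA Y1 mulmx1.
    rewrite scalemxAr -mulmxA; congr (_ *m _).
    rewrite {1}YE /N !mulmxA AF -(mulmxA E (diag_mx _)).
    rewrite (_ : diag_mx _ *m diag_mx _ = a%:M); last first.
      rewrite mul_diag_mx; apply/matrixP => i j; rewrite !mxE.
      case: eqVneq => [->|_]; rewrite ?mulr1n ?mulr0n ?mulr0//.
      by rewrite mulrC divfK// gt_eqF.
    by rewrite mul_mx_scalar -!scalemxAl.
  apply: schatten_normMr_le => //.
  apply: contractionM cY; apply: contractionM (contraction_tr cE).
  apply: contractionM => //; apply: diag_contraction => i.
  rewrite mxE ger0_norm; last by rewrite divr_ge0// ltW.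
  by rewrite ler_pdivrMr// mul1r.
have -> : K *m A = K *m Ak + K *m (A - Ak) by rewrite -mulmxDr addrC subrK.
apply: le_trans (schatten_normD _ _ p_ge1) _; apply: lerD; last first.
  by apply/schatten_normMl_le/projector_contraction/projectorC.
(* [(1 - P) A_k = sigma_1 (1 - P) Y (Y^T U_k (Sigma_k / sigma_1) V_k^T)] *)
rewrite -schatten_normZ//.
pose N := Y^T *m E *m diag_mx (\row_(j < k) (s`_j / b)) *m F^T.
have -> : K *m Ak = (b *: (K *m Y)) *m N.
  rewrite -scalemxAl -mulmxA scalemxAr; congr (_ *m _).
  rewrite AkE /N !mulmxA YY PkE -(mulmxA E E^T E) EE mulmx1.
  rewrite scalemxAl scalemxAr; congr (_ *m _ *m _).
  apply/matrixP => i j; rewrite !mxE mulrnAr.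
  by rewrite mulrC divfK// gt_eqF.
apply: schatten_normMr_le => //.
apply: contractionM (contraction_tr cF); apply: contractionM.
  by apply: contractionM => //; exact: contraction_tr.
apply: diag_contraction => i.
rewrite mxE ger0_norm; last by rewrite divr_ge0// ltW.
by rewrite ler_pdivrMr// mul1r.
Qed.
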